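(* For a topological space $X$ with a locally uniform $\omega^\omega$-base the following conditions are equivalent: (1) $X$ is metrizable; (2) $X$ is a first-countable closed-$\bar G_\delta$ $T_0$-space; (3) $X$ is an $M$-space; (4) $X$ is a first-countable collectionwise normal $\Sigma$-space; (5) $X$ is a first-countable strong $\sigma$-space.
   Context: An entourage on $X$ is a subset of $X\times X$ containing the diagonal; $U[x]=\{y:(x,y)\in U\}$; products and inverses of entourages are compositions and inverses of relations. A locally uniform $\omega^\omega$-base for $X$ is a family $(U_\alpha)_{\alpha\in\omega^\omega}$ of entourages on $X$ such that $U_\beta\subset U_\alpha$ for all $\alpha\le\beta$ (coordinatewise order on $\omega^\omega$); for every $x\in X$ the family $\{U_\alpha[x]\}_\alpha$ is a neighborhood base at $x$; and for every $x\in X$ and neighborhood $O_x$ of $x$ there is $\alpha$ with $U_\alpha U_\alpha^{-1}U_\alpha[x]\subset O_x$. Regular means: every neighborhood of each point contains a closed neighborhood of that point. $X$ is closed-$\bar G_\delta$ if for each closed $F\subset X$ there is a sequence $(W_n)$ of open sets with $F=\bigcap_nW_n=\bigcap_n\overline W_n$. A family $\mathcal F$ of subsets of $X$ is discrete if each point has a neighborhood meeting at most one member of $\mathcal F$; strongly discrete if each $F\in\mathcal F$ has an open neighborhood $U_F$ such that $(U_F)_{F\in\mathcal F}$ is discrete; (strongly) $\sigma$-discrete if it is a countable union of (strongly) discrete families. $X$ is collectionwise normal if each discrete family of closed sets is strongly discrete. A network is a family $\mathcal N$ such that for any open $U$ and $x\in U$ there is $N\in\mathcal N$ with $x\in N\subset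 U$. A strong $\sigma$-space is a regular $T_0$-space with a strongly $\sigma$-discrete network. A $\Sigma$-space is a regular $T_0$-space having, for some cover $\mathcal C$ by closed countably compact subspaces, a $\sigma$-discrete family $\mathcal N$ such that for each $C\in\mathcal C$ and open $U\supset C$ there is $N\in\mathcal N$ with $C\subset N\subset U$. An $M$-space is a regular $T_0$-space admitting a sequence $(\mathcal U_n)_{n\in\omega}$ of open covers such that $\mathcal U_{n+1}$ star-refines $\mathcal U_n$ (for each $V\in\mathcal U_{n+1}$ the union of all members of $\mathcal U_{n+1}$ meeting $V$ lies in some member of $\mathcal U_n$) and for every $x\in X$ any sequence $(x_n)_{n\in\omega}$ with $x_n\in\bigcup\{U\in\mathcal U_n:x\in U\}$ for all $n$ has an accumulation point in $X$. *)

(* Defs.v *)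
From mathcomp Require Import all_boot all_order all_algebra.
From mathcomp Require Import all_classical all_reals.
From mathcomp Require Import topology metric_structure.

Set Implicit Arguments.
Unset Strict Implicit.
Unset Printing Implicit Defensive.

Local Open Scope classical_set_scope.

(* omega^omega is [nat -> nat], ordered pointwise.  An entourage here is any relation
   containing the diagonal: it need not belong to a uniform structure, so this
   is not the [entourage] of [uniformType]. *)
Definition locally_uniform_base (X : topologicalType)
    (U : (nat -> nat) -> set (X * X)) : Prop :=
  [/\ forall a, diagonal `<=` U a,
      forall a b, (forall n, (a n <= b n)%N) -> U b `<=` U a,
      forall x : X, nbhs x = filter_from setT (fun a => xsection (U a) x) &
      forall (x : X) (O : set X), nbhs x O ->
        exists a, xsection (U a \; (U a)^-1 \; U a)%relation x `<=` O].

Definition metrizable (R : realType) (X : topologicalType) : Prop :=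
  exists (M : metricType R) (f : X -> M) (g : M -> X),
    [/\ cancel f g, cancel g f, continuous f & continuous g].

Definition first_countable (X : topologicalType) : Prop :=
  forall x : X, exists2 B : set (set X), countable B & nbhs x = filter_from B id.

Definition closed_bar_Gdelta (X : topologicalType) : Prop :=
  forall F : set X, closed F -> exists W : nat -> set X,
    [/\ forall n, open (W n), F = \bigcap_n W n & F = \bigcap_n closure (W n)].

(* The family is indexed: two distinct indices count as two members even if the
   sets coincide, which is what discreteness of (U_F)_(F in FF) requires below.
   A set FF of subsets is viewed as the family [id] indexed by FF. *)
Definition discrete_family (X : topologicalType) (I : Type) (D : set I)
    (F : I -> set X) : Prop :=
  forall x : X, exists2 O : set X, nbhs x O &
    forall i j, D i -> D j -> O `&` F i !=set0 -> O `&` F j !=set0 -> i = j.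

Definition discrete_sets (X : topologicalType) (FF : set (set X)) : Prop :=
  discrete_family FF id.

Definition strongly_discrete (X : topologicalType) (FF : set (set X)) : Prop :=
  exists2 U : set X -> set X,
    forall F, FF F -> open (U F) /\ F `<=` U F & discrete_family FF U.

Definition sigma_discrete (X : topologicalType) (FF : set (set X)) : Prop :=
  exists2 G : nat -> set (set X),
    forall n, discrete_sets (G n) & FF = \bigcup_n G n.

Definition strongly_sigma_discrete (X : topologicalType)
    (FF : set (set X)) : Prop :=
  exists2 G : nat -> set (set X),
    forall n, strongly_discrete (G n) & FF = \bigcup_n G n.

Definition collectionwise_normal (X : topologicalType) : Prop :=
  forall FF : set (set X), FF `<=` closed -> discrete_sets FF ->
    strongly_discrete FF.

Definition network (X : topologicalType) (N : set (set X)) : Prop :=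
  forall (U : set X) (x : X), open U -> U x ->
    exists2 A, N A & A x /\ A `<=` U.

Definition regular_T0 (X : topologicalType) : Prop :=
  regular_space X /\ kolmogorov_space X.

Definition strong_sigma_space (X : topologicalType) : Prop :=
  regular_T0 X /\
  exists2 N : set (set X), strongly_sigma_discrete N & network N.

Definition countably_compact (X : topologicalType) (A : set X) : Prop :=
  forall U : nat -> set X, (forall n, open (U n)) -> A `<=` cover setT U ->
    finite_subset_cover setT U A.

Definition Sigma_space (X : topologicalType) : Prop :=
  regular_T0 X /\
  exists CC N : set (set X),
    [/\ cover CC id = setT,
        forall C, CC C -> closed C /\ countably_compact C,
        sigma_discrete N &
        forall C U : set X, CC C -> open U -> C `<=` U ->
          exists2 A, N A & C `<=` A /\ A `<=` U].

Definition open_cover (X : topologicalType) (UU : set (set X)) : Prop :=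
  UU `<=` open /\ cover UU id = setT.

Definition star_refines (X : Type) (VV UU : set (set X)) : Prop :=
  forall V, VV V -> exists2 U, UU U &
    \bigcup_(W in [set W | VV W /\ W `&` V !=set0]) W `<=` U.

(* [cluster (x_ @ \oo)] is the set of accumulation points of the sequence, i.e.
   of the p each neighbourhood of which contains x_ n for infinitely many n. *)
Definition M_space (X : topologicalType) : Prop :=
  regular_T0 X /\
  exists UU : nat -> set (set X),
    [/\ forall n, open_cover (UU n),
        forall n, star_refines (UU n.+1) (UU n) &
        forall (x : X) (x_ : nat -> X),
          (forall n, (\bigcup_(U in [set U | UU n U /\ U x]) U) (x_ n)) ->
          cluster (x_ @ \oo) !=set0].

(* Main.v *)
Require Import Defs.
From HB Require Import structures.
From mathcomp Require Import all_boot all_order all_algebra.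
From mathcomp Require Import all_classical all_reals.
From mathcomp Require Import topology metric_structure.
From mathcomp Require finmap.
From mathcomp Require Import wochoice lra.

Set Implicit Arguments.
Unset Strict Implicit.
Unset Printing Implicit Defensive.

Import Order.TTheory GRing.Theory Num.Theory.

Local Open Scope classical_set_scope.

(** Write [a|m] for the first [m] values of [a], and [U_s] for the intersection
of the [U_b] over all [b] extending the finite sequence [s].  There are only
countably many [U_s], and they carry all the information needed.  The reason is
a diagonal argument: if [b_m] extends [a|m] for every [m], then all the [b_m]
lie below a single [c], since at each coordinate all but finitely many of them
agree with [a] ([cylinder_ub]).  Hence in a first-countable space, for all [x]
and [a], some [U_{a|m}[x]] is a neighbourhood of [x]: otherwise choose [b_m]
such that [U_{b_m}[x]] does not contain the [m]-th basic neighbourhood of [x];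
then [U_c[x]] contains none of them.

So the open sets [O_s], the union over [x] of the interiors of [U_s[x]],
satisfy: [O_{a|m}] increases with [m] and covers [X], for each fixed [a]
([prefix_domain_cover]).  Each point of [O_s] is interior to some [U_s[x]], but
outside [O_s] nothing is known about [U_s].  This is repaired whenever one has,
for each [s], countably many open [P_{s,n}] with closure in [O_s]: relate [y] and
[z] if both belong to some [U_s[x]], or if both avoid the closure of [P_{s,n}].
Each of these countably many relations assigns a neighbourhood to every point,
the second clause never applies to a point of [P_{s,n}], and local uniformity of
the base then yields the hypothesis of Frink's metrization theorem
([frink_metrization]), provided that for all [a] each point is in some
[P_{a|m,n}] ([metrizable_of_shrinking]).

It remains to produce the [P_{s,n}].
- In a closed-bar-G_delta space, write the complement of [O_s] as
  the intersection of open [W_n] and of their closures, and take the complement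
  of the closure of [W_n].
- A strong sigma-space is closed-bar-G_delta, because a strongly discrete family
  of sets can be enlarged to a family of open sets whose union has as closure
  the union of the closures.
- In a collectionwise normal Sigma-space, a countably compact [C] is contained
  in some [O_{a|m}], as these increase; the members of the [n]-th discrete family
  with closure in [O_s] have a closed union inside [O_s], and normality
  gives [P_{s,n}] around it.
- In an M-space take the interior of the set of points whose star in the [n]-th
  cover is inside [O_s].
  First countability of an M-space comes from a second diagonal argument
  ([star_totally_bounded]): for some [m] the star of [x] in the [m]-th cover is
  covered by finitely many sets [(U_{a|m} U_{a|m}^-1)[d]].  This gives countably
  many sets forming a network at the points of the intersection of the
  stars of [x], and separating [x] from these sets by open sets whenever
  possible yields a countable base at [x].

Conversely a metric space has all the other properties; the one nontrivial
ingredient is a strongly sigma-discrete network, obtained from a well-ordering of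
the points as in Stone's theorem ([metric_network]). *)

(** * Countable intersections of neighbourhoods *)

Lemma nbhs_forall_pickle (X : topologicalType) (I : countType) (x : X)
    (A : I -> set X) n : (forall i, nbhs x (A i)) ->
  nbhs x [set y | forall i, (pickle i < n)%N -> A i y].
Proof.
move=> Ax; elim: n => [|n IH]; first by apply: filterS filterT => y _ i.
have : nbhs x [set y | forall i, pickle i = n -> A i y].
  have [[i ni]|no] := pselect (exists i : I, pickle i = n); last first.
    by apply: filterS filterT => y _ i ni; case: no; exists i.
  apply: filterS (Ax i) => y Aiy j nj.
  by rewrite (pcan_inj (@pickleK I) (_ : pickle j = pickle i)) // nj.
apply: filterS2 IH => y lty eqy i; rewrite ltnS leq_eqVlt => /orP[/eqP|].
  exact: eqy.
exact: lty.
Qed.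

Lemma first_countable_seq (X : topologicalType) (x : X) :
  first_countable X -> exists2 B : nat -> set X, forall n, nbhs x (B n) &
    forall O, nbhs x O -> exists n, B n `<=` O.
Proof.
move=> /(_ x)[BB cB nB]; have sub A : BB A -> nbhs x A.
  by rewrite nB => BA; exists A.
case/pfcard_geP: cB => [B0|/unsquash f].
  have : nbhs x setT by exact: filterT.
  by rewrite nB B0 => -[].
have fx i : nbhs x (f i) by apply/sub/funS.
exists f => // O; rewrite nB => -[A BA AO].
by have [n _ nA] := @surj _ _ _ _ f A BA; exists n; rewrite nA.
Qed.

(** * Metrizability *)

(** Transporting the distance along the homeomorphism lets all later arguments
live on [X] itself. *)
Definition compatible_metric (R : realType) (X : topologicalType)
    (d : X -> X -> R) : Prop :=
  [/\ [/\ forall x, d x x = 0%R, forall x y, d x y = 0%R -> x = y,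
      forall x y, d x y = d y x &
      forall y x z, (d x z <= d x y + d y z)%R] &
      forall x (A : set X), nbhs x A <->
        exists2 e : R, (0 < e)%R & forall y, (d x y < e)%R -> A y].

Lemma metrizableP (R : realType) (X : topologicalType) :
  metrizable R X <-> exists d : X -> X -> R, compatible_metric d.
Proof.
split=> [[M [f [g [fK gK fc gc]]]]|[d [[d0 dpos dsym dtri] dnbhs]]].
  exists (fun x y => mdist (f x) (f y)); split; first split.
  - by move=> x; exact: mdistxx.
  - by move=> x y /mdist_positivity/(can_inj fK).
  - by move=> x y; exact: metric_sym.
  - by move=> y x z; exact: metric_triangle.
  move=> x A; split.
  - rewrite -{1}(fK x) => /gc; rewrite -nbhs_ballE => -[e /= e0 eA].
    exists e => // y xy; have := eA (f y); rewrite /= fK; apply.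
    by rewrite ballEmdist.
  - move=> [e e0 eA].
    have fe : nbhs x (f @^-1` ball (f x) e) by exact/fc/nbhsx_ballx.
    by apply: filterS fe => y; rewrite /= ballEmdist => /eA.
pose M : metricType R :=
  HB.pack (Choice.sort X) (isMetric.Build R (Choice.sort X) d0 dpos dsym dtri).
have Mnbhs (x : M) (A : set M) : nbhs x A <->
    exists2 e : R, (0 < e)%R & forall y, (d x y < e)%R -> A y.
  rewrite -nbhs_ballE; by split=> -[e /= e0 eA]; exists e.
exists M, (fun x : X => x : M), (fun x : M => x : X); split=> // x A.
  by move=> /Mnbhs/dnbhs.
by move=> /dnbhs/Mnbhs.
Qed.

(** A decreasing sequence of symmetric relations with [D_{n+1} D_{n+1}] inside
[D_n] is a countable base of a uniformity, and a uniformity with a countable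
base is induced by a pseudometric.  As the pseudometric is given by its balls,
the distance is recovered as the infimum of the radii. *)
Section metric_of_entourages.
Variables (R : realType) (X : topologicalType) (D : nat -> set (X * X)).
Hypothesis Drefl : forall n x, D n (x, x).
Hypothesis Dsym : forall n x y, D n (x, y) -> D n (y, x).
Hypothesis Dsplit : forall n x y z,
  D n.+1 (x, y) -> D n.+1 (y, z) -> D n (x, z).
Hypothesis Dnbhs : forall x A,
  nbhs x A <-> exists n, forall y, D n (x, y) -> A y.
Hypothesis X0 : kolmogorov_space X.

Let Ddecr n m : (n <= m)%N -> D m `<=` D n.
Proof.
move=> nm; rewrite -(subnKC nm); elim: (m - n)%N => [|k IH].
  by rewrite addn0.
by rewrite addnS => -[x y] Dxy; apply/IH/(Dsplit Dxy).
Qed.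

Let ent : set_system (X * X) := filter_from setT D.

Let ent_filter : Filter ent.
Proof.
apply: filter_from_filter; first by exists 0%N.
move=> i j _ _; exists (maxn i j) => // xy Dxy; split.
  exact: Ddecr (leq_maxl _ _) _ Dxy.
exact: Ddecr (leq_maxr _ _) _ Dxy.
Qed.

Let ent_refl A : ent A -> diagonal `<=` A.
Proof. by move=> [n _ DA] [x y] xy; apply: DA; rewrite (xy : x = y). Qed.

Let ent_inv A : ent A -> ent (A^-1)%relation.
Proof. by move=> [n _ DA]; exists n => // -[x y] /Dsym/DA. Qed.

Let ent_split A : ent A -> exists2 B, ent B & (B \; B)%relation `<=` A.
Proof.
move=> [n _ DA]; exists (D n.+1); first by exists n.+1.
by move=> [x z] [y /= Dxy Dyz]; apply/DA/(Dsplit Dxy).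
Qed.

Let nbhs_ent : nbhs = nbhs_ ent.
Proof.
apply/funext => x; apply/seteqP; split=> A.
  move=> /Dnbhs[n DA]; exists (D n); first by exists n.
  by move=> y /xsectionP/DA.
move=> [E [n _ DE] EA]; apply/Dnbhs; exists n => y Dxy.
by apply/EA/xsectionP/DE.
Qed.

(** A copy of [X]; the dependence on [Dnbhs] forces the instances below to be
attached to the topology of [X]. *)
Definition entourage_space : Type := let _ := Dnbhs in X.
HB.instance Definition _ := Nbhs.copy entourage_space X.
HB.instance Definition _ :=
  Nbhs_isUniform.Build entourage_space
    ent_filter ent_refl ent_inv ent_split nbhs_ent.

Lemma entourage_space_countable : countable_uniformity entourage_space.
Proof.
apply/countable_uniformityP; exists D; last by move=> n; exists n.
by move=> A [n _ DA]; exists n.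
Qed.

Local Notation M := (countable_uniform.type entourage_space_countable).

Let radii (x y : M) : set R := [set e | (0 < e)%R /\ ball x e y].

Let dist (x y : M) : R := inf (radii x y).

Let radii_inf x y : has_inf (radii x y).
Proof.
split; last by exists 0%R => e [/ltW].
by exists 2%R; split=> //; exact: countable_uniform.countable_uniform_bounded.
Qed.

Let dist_ball x y e : (dist x y < e)%R -> ball x e y.
Proof.
by move=> /(inf_lt (radii_inf x y).1) [r [_ xy]] /ltW re; exact: (le_ball re).
Qed.

Let ball_dist x y e : (0 < e)%R -> ball x e y -> (dist x y <= e)%R.
Proof. by move=> e0 xy; apply: ge_inf; [exact: (radii_inf x y).2|split]. Qed.

Lemma metrizable_of_entourages : metrizable R X.
Proof.
have dist_nbhs (x : X) (A : set X) : nbhs x A <->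
    exists2 e : R, (0 < e)%R & forall y, (dist x y < e)%R -> A y.
  have -> : nbhs x A = @nbhs M M x A by [].
  rewrite -(@nbhs_ballE R M); split=> -[e /= e0 eA]; last first.
    have e20 : (0 < e / 2)%R by exact: divr_gt0.
    exists (e / 2)%R => // y /(ball_dist e20) xy; apply: eA.
    by rewrite (le_lt_trans xy) // ltr_pdivrMr // ltr_pMr // ltr1n.
  by exists e => // y /dist_ball/eA.
have dist_ge0 x y : (0 <= dist x y)%R.
  by apply: lb_le_inf; [exact: (radii_inf x y).1|move=> e [/ltW]].
have dist_sym x y : dist x y = dist y x.
  suff le z t : (dist z t <= dist t z)%R by apply/le_anti; rewrite !le.
  apply: lb_le_inf; first exact: (radii_inf t z).1.
  by move=> e [e0 /ball_sym]; exact: ball_dist.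
have dist_eq x : dist x x = 0%R.
  apply/le_anti; rewrite dist_ge0 andbT; apply/ler_addgt0Pl => e e0.
  by rewrite addr0; apply: ball_dist => //; exact: ballxx.
apply/metrizableP; exists dist; split=> //; split=> //.
  move=> x y xy0; apply/eqP/negP => /negP/X0 [A [[]|[]]]; rewrite !inE.
    by move=> /dist_nbhs [e e0 eA]; apply; apply: eA; rewrite xy0.
  by move=> /dist_nbhs [e e0 eA]; apply; apply: eA; rewrite dist_sym xy0.
have tri e y x z : (0 < e)%R -> (dist x z <= e + (dist x y + dist y z))%R.
  move=> e0; have e20 : (0 < e / 2)%R by exact: divr_gt0.
  have xy : @ball R M x (dist x y + e / 2)%R y.
    by apply: dist_ball; rewrite ltrDl.
  have yz : @ball R M y (dist y z + e / 2)%R z.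
    by apply: dist_ball; rewrite ltrDl.
  have -> : (e + (dist x y + dist y z) =
    (dist x y + e / 2) + (dist y z + e / 2))%R by lra.
  apply: ball_dist; last exact: ball_triangle xy yz.
  by have := dist_ge0 x y; have := dist_ge0 y z; lra.
by move=> y x z; apply/ler_addgt0Pl => e; exact: tri.
Qed.
End metric_of_entourages.

(** Frink's metrization theorem.  The local condition says that, for each [x]
and [j], there is [m] such that every [V_m(y)] meeting [V_m(x)] is inside
[V_j(x)]; here [m] depends on [x].  Iterating it, let [k_{n+1}(x)] be the [m]
associated with [x] and [k_n(x)].  If [V_{k_{n+1}(a)}(a)] meets
[V_{k_{n+1}(b)}(b)] and [k_{n+1}(b)] is the smaller index, then the former set is
inside [V_{k_n(b)}(b)], and so is the latter.  Hence two meeting members of the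
cover of level [n+1] lie in one member of the cover of level [n], which is a
uniform condition. *)
Section frink.
Variables (R : realType) (X : topologicalType) (I : countType).
Variable E : I -> set (X * X).
Hypothesis Esym : forall i x y, E i (x, y) -> E i (y, x).
Hypothesis Enbhs : forall i x, nbhs x [set y | E i (x, y)].
Hypothesis Ebase : forall (x : X) (O : set X), nbhs x O ->
  exists2 V : set X, nbhs x V & exists i, forall y z, V y -> E i (y, z) -> O z.
Hypothesis X0 : kolmogorov_space X.

Let V n (x : X) : set X := [set y | forall i, (pickle i < n)%N -> E i (x, y)].

Let V_nbhs n x : nbhs x (V n x).
Proof. by apply: nbhs_forall_pickle => i; exact: Enbhs. Qed.

Let V_decr n m x : (n <= m)%N -> V m x `<=` V n x.
Proof. by move=> nm y Vy i /leq_trans => /(_ _ nm)/Vy. Qed.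

Let V_refl n x : V n x x.
Proof. exact: nbhs_singleton. Qed.

Let V_sym n x y : V n x y -> V n y x.
Proof. by move=> Vxy i /Vxy/Esym. Qed.

Let V_base (x : X) (O : set X) : nbhs x O ->
  exists n, forall y z, V n x y -> V n y z -> O z.
Proof.
move=> /Ebase[A Ax [i Ai]]; have [B Bx [j Bj]] := Ebase Ax.
exists (maxn (pickle i).+1 (pickle j).+1) => y z Vxy Vyz; apply: Ai (Vyz i _).
  by apply: Bj (Vxy j _); [exact: nbhs_singleton|rewrite leq_max leqnn orbT].
by rewrite leq_max leqnn.
Qed.

Let V_meet x j : exists2 m, (j < m)%N &
  forall y, V m x `&` V m y !=set0 -> V m y `<=` V j x.
Proof.
have [n nV] := V_base (V_nbhs j x); have [m mV] := V_base (V_nbhs n x).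
pose k := maxn j.+1 (maxn n m); exists k; first exact: leq_maxl.
have nk : (n <= k)%N by rewrite !leq_max leqnn orbT.
have mk : (m <= k)%N by rewrite !leq_max leqnn !orbT.
move=> y [z [/(V_decr mk) xz /(V_decr mk)/V_sym zy]] t /(V_decr nk).
exact/nV/mV/zy.
Qed.

Let m x j := s2val (cid2 (V_meet x j)).

Let m_gt x j : (j < m x j)%N.
Proof. exact: s2valP (cid2 (V_meet x j)). Qed.

Let m_meet x j y : V (m x j) x `&` V (m x j) y !=set0 -> V (m x j) y `<=` V j x.
Proof. exact: s2valP' (cid2 (V_meet x j)) y. Qed.

Let k x n := iter n (m x) 0%N.

Let k_ge x n : (n <= k x n)%N.
Proof. by elim: n => // n IH; rewrite (leq_ltn_trans IH) // m_gt. Qed.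

Let D n : set (X * X) :=
  [set yz | exists x, V (k x n) x yz.1 /\ V (k x n) x yz.2].

Let D_split n x y z : D n.+1 (x, y) -> D n.+1 (y, z) -> D n (x, z).
Proof.
move=> [a /= [ax ay]] [b /= [bY bz]].
wlog ba : a b x z ax ay bY bz / (k b n.+1 <= k a n.+1)%N => [IH|].
  have [ba|/ltnW ab] := leqP (k b n.+1) (k a n.+1).
    exact: IH ax ay bY bz ba.
  by have [c /= []] := IH _ _ _ _ bz bY ay ax ab; exists c.
exists b; split=> /=.
  by apply: (@m_meet b (k b n) a); [exists y; split=> //|]; exact: V_decr ba _ _.
exact: V_decr (ltnW (m_gt b (k b n))) _ bz.
Qed.

Lemma frink_metrization : metrizable R X.
Proof.
apply: (@metrizable_of_entourages R X D) => //.
- by move=> n x; exists x; split; exact: V_refl.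
- by move=> n x y [a [ax ay]]; exists a.
move=> x O; split=> [xO|[n nO]]; last first.
  apply: filterS (V_nbhs (k x n) x) => y xy; apply: nO.
  by exists x; split=> //; exact: V_refl.
have [j jO] := V_base xO.
exists (m x j) => y [b /= [bx bY]]; apply: (jO x); first exact: V_refl.
apply: (@m_meet x j b); last exact: V_decr (k_ge b _) _ bY.
by exists x; split; [exact: V_refl|exact: V_decr (k_ge b _) _ bx].
Qed.
End frink.

(** * Entourages indexed by finite sequences *)

Definition cylinder (s : seq nat) : set (nat -> nat) :=
  [set b | forall i, (i < size s)%N -> b i = nth 0%N s i].

Lemma cylinder_mkseq (a : nat -> nat) m b :
  cylinder (mkseq a m) b <-> forall i, (i < m)%N -> b i = a i.
Proof.
split=> ab i; last by rewrite size_mkseq => im; rewrite nth_mkseq // ab.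
by move=> im; rewrite ab ?nth_mkseq // size_mkseq.
Qed.

Lemma cylinder_self a m : cylinder (mkseq a m) a.
Proof. exact/cylinder_mkseq. Qed.

Lemma cylinder_decr a m n : (m <= n)%N ->
  cylinder (mkseq a n) `<=` cylinder (mkseq a m).
Proof.
move=> mn b /cylinder_mkseq ab; apply/cylinder_mkseq => i im.
exact/ab/(leq_trans im).
Qed.

(** At coordinate [n] only the [b_m] with [m <= n] can differ from [a], so the
supremum is finite. *)
Lemma cylinder_ub a (b : nat -> nat -> nat) :
  (forall m, cylinder (mkseq a m) (b m)) ->
  exists c, forall m n, (b m n <= c n)%N.
Proof.
move=> ab; exists (fun n => maxn (a n) (\max_(m < n.+1) b m n)) => m n.
rewrite leq_max; have [mn|nm] := leqP m n.
  by rewrite (leq_bigmax (Ordinal (mn : m < n.+1)%N)) orbT.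
by move/cylinder_mkseq: (ab m) => /(_ n nm) ->; rewrite leqnn.
Qed.

Section omega_base.
Variables (X : topologicalType) (U : (nat -> nat) -> set (X * X)).
Hypothesis hU : locally_uniform_base U.

Lemma omega_base_refl a x : U a (x, x).
Proof. by case: hU => + _ _ _; apply. Qed.

Lemma omega_base_decr a b x y :
  (forall n, (a n <= b n)%N) -> U b (x, y) -> U a (x, y).
Proof. by case: hU => _ + _ _ ab; apply. Qed.

Lemma omega_base_nbhs a x : nbhs x [set y | U a (x, y)].
Proof.
case: hU => _ _ /(_ x) -> _; by exists a => // y /xsectionP.
Qed.

(** Local uniformity at [x], applied twice: first for [A], giving [a], then for
the neighbourhood [U_a[x]]. *)
Lemma omega_base_four_steps (x : X) (O : set X) : nbhs x O ->
  exists a, forall c y d z, U a (c, x) -> U a (c, y) -> U a (d, y) ->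
    U a (d, z) -> O z.
Proof.
have three (A : set X) : nbhs x A ->
    exists a, forall y d z, U a (x, y) -> U a (d, y) -> U a (d, z) -> A z.
  case: hU => _ _ _ hA /hA[a aA]; exists a => y d z xy dy dz.
  by apply/aA/xsectionP; exists d => //; exists y.
move=> /three[a aO]; have [b bO] := three _ (omega_base_nbhs a x).
exists (fun n => maxn (a n) (b n)) => c y d z.
have Ua u v : U (fun n => maxn (a n) (b n)) (u, v) -> U a (u, v).
  by apply: omega_base_decr => n; exact: leq_maxl.
have Ub u v : U (fun n => maxn (a n) (b n)) (u, v) -> U b (u, v).
  by apply: omega_base_decr => n; exact: leq_maxr.
move=> /Ub cx /Ub cy /Ua dy /Ua dz; apply: aO dy dz.
exact: bO (omega_base_refl _ _) cx cy.
Qed.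

Definition prefix_entourage (s : seq nat) : set (X * X) :=
  [set xy | forall b, cylinder s b -> U b xy].

Definition prefix_domain (s : seq nat) : set X :=
  \bigcup_x (xsection (prefix_entourage s) x)°.

Lemma prefix_domain_open s : open (prefix_domain s).
Proof. by apply: bigcup_open => x _; exact: open_interior. Qed.

Lemma prefix_domain_incr a m n : (m <= n)%N ->
  prefix_domain (mkseq a m) `<=` prefix_domain (mkseq a n).
Proof.
move=> mn y [x _ xy]; exists x => //; apply: interiorS xy => z /xsectionP xz.
by apply/xsectionP => b /(cylinder_decr mn)/xz.
Qed.

(** If [U_{a|m}[x]] is never a neighbourhood of [x], it misses a point of the
[m]-th basic neighbourhood because of some [b_m] extending [a|m], and a common
bound of the [b_m] contradicts that [U_c[x]] is a neighbourhood. *)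
Lemma prefix_domain_cover a x :
  first_countable X -> exists m, prefix_domain (mkseq a m) x.
Proof.
move=> Xfc; suff [m xm] : exists m,
    nbhs x (xsection (prefix_entourage (mkseq a m)) x).
  by exists m, x.
have [B Bx Bbase] := first_countable_seq x Xfc.
apply: contrapT => no.
have /choice[b bP] m : exists b, cylinder (mkseq a m) b /\
    ~ [set y | forall i, (pickle i < m)%N -> B i y] `<=` [set y | U b (x, y)].
  apply: contrapT => nob; apply: no; exists m.
  apply: filterS (nbhs_forall_pickle m Bx) => y By; apply/xsectionP => b ab.
  by apply: contrapT => nU; apply: nob; exists b; split=> // /(_ y By).
have [c cP] := cylinder_ub (fun m => (bP m).1).
have [n nB] := Bbase _ (omega_base_nbhs c x).
apply: (bP (pickle n).+1).2 => y /(_ n (ltnSn _))/nB; exact: omega_base_decr.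
Qed.

(** A point [y] of [P_{s,n}] can be related to another point only through some
[U_s[d]], which for [s = a|m] is inside [U_a[d]]; so [z] is reached from [x] by
steps in [U_a] and its inverse, whose number does not depend on [m] and [n].  Off
the closure of [P_{s,n}] the second clause makes the relation a
neighbourhood. *)
Lemma metrizable_of_shrinking (R : realType) (P : seq nat -> nat -> set X) :
  kolmogorov_space X ->
  (forall s n, open (P s n)) ->
  (forall s n, closure (P s n) `<=` prefix_domain s) ->
  (forall a x, exists m n, P (mkseq a m) n x) ->
  metrizable R X.
Proof.
move=> X0 Po Pc Pcov.
pose E (sn : seq nat * nat) : set (X * X) := [set yz |
  (exists c, prefix_entourage sn.1 (c, yz.1) /\ prefix_entourage sn.1 (c, yz.2))
  \/ ~ closure (P sn.1 sn.2) yz.1 /\ ~ closure (P sn.1 sn.2) yz.2].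
apply: (@frink_metrization R X _ E) => //.
- by move=> i x y [[c []]|[]] /= ? ?; [left; exists c|right].
- move=> [s n] x; have [xP|xP] := pselect (closure (P s n) x).
    have [c _ cx] := Pc _ _ _ xP; have /xsectionP cxx := nbhs_singleton cx.
    apply: filterS cx => y /xsectionP cy.
    by left; exists c; split=> //; exact: cxx.
  have : nbhs x (~` closure (P s n)).
    by apply: open_nbhs_nbhs; split=> //; exact/closed_openC/closed_closure.
  by apply: filterS => y yP; right.
move=> x O /omega_base_four_steps[a aO]; have [m [n xP]] := Pcov a x.
have [c _ cx] := Pc _ _ _ (subset_closure xP).
exists (P (mkseq a m) n `&` xsection (prefix_entourage (mkseq a m)) c).
  by apply: filterI cx; exact: open_nbhs_nbhs.
exists (mkseq a m, n) => y z [yP /xsectionP cy] [[d /= [dy dz]]|[/=]]; last first.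
  by move=> + _; case; exact: subset_closure.
have ca := @cylinder_self a m.
apply: (aO c y d z); [|exact: cy|exact: dy|exact: dz].
by have /xsectionP := nbhs_singleton cx; apply.
Qed.
End omega_base.

(** * Discrete families *)

Lemma sub_discrete_family (X : topologicalType) (I : Type) (D D' : set I)
    (F F' : I -> set X) :
  D' `<=` D -> (forall i, D' i -> F' i `<=` F i) ->
  discrete_family D F -> discrete_family D' F'.
Proof.
move=> DD FF dF x; have [O xO OF] := dF x; exists O => // i j Di Dj Oi Oj.
by apply: OF; [exact: DD|exact: DD|case: Oi|case: Oj] => y [Oy Fy];
  exists y; split=> //; apply: FF Fy.
Qed.

Lemma closure_discrete_bigcup (X : topologicalType) (I : Type) (D : set I)
    (F : I -> set X) : discrete_family D F ->
  closure (\bigcup_(i in D) F i) `<=` \bigcup_(i in D) closure (F i).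
Proof.
move=> dF x xF; have [O xO OF] := dF x.
have [y [[i Di iy] Oy]] := xF _ xO; exists i => // B xB.
have [z [[j Dj jz] [Oz Bz]]] := xF _ (filterI xO xB).
suff ij : i = j by exists z; rewrite ij.
by apply: OF => //; [exists y|exists z].
Qed.

(** Two disjoint closed sets form a discrete family, so collectionwise normality
includes normality.  If [F] equals the complement of [O] that family has a
single member, but then both are empty. *)
Lemma collectionwise_normal_shrink (X : topologicalType) (F O : set X) :
  collectionwise_normal X -> closed F -> open O -> F `<=` O ->
  exists P, [/\ open P, F `<=` P & closure P `<=` O].
Proof.
move=> cwn cF oO FO; have [FE|FnO] := pselect (F = ~` O).
  exists set0; split; [exact: open0| |by rewrite closure0].
  by rewrite {1}FE => y ny; case: (ny); apply/FO; rewrite FE.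
have cO : closed (~` O) by exact: open_closedC.
have [||V VO dV] := cwn [set F; ~` O].
- by move=> ? [->|->].
- move=> x; exists (if x \in O then O else ~` F).
    case: ifPn => [/set_mem xO|/negP xO]; apply: open_nbhs_nbhs; split=> //.
      exact: closed_openC.
    by move=> /FO/mem_set.
  case: ifP => _ i j [->|->] [->|->] //=.
  + by move=> _ [y []].
  + by move=> [y []].
  + by move=> [y []].
  + by move=> _ [y []].
have [oF FF] := VO F (or_introl erefl).
have [oOV OV] := VO (~` O) (or_intror erefl).
exists (V F); split=> // x xV; apply: contrapT => xO.
have [E xE EV] := dV x.
have [y [Fy [Ey Vy]]] : V F `&` (E `&` V (~` O)) !=set0.
  by apply/xV/filterI => //; apply: open_nbhs_nbhs; split=> //; exact: OV.
apply: FnO; apply: EV; [by left|by right| |].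
  by exists y.
by exists y.
Qed.

(** For an open set [O] and a level [n] of the network, take those members that
have an open neighbourhood with closure in [O], and intersect such a
neighbourhood with the given discrete expansion: by discreteness the closure of
the union of these open sets is still inside [O], and by regularity these
unions exhaust [O]. *)
Lemma strong_sigma_closed_bar_Gdelta (X : topologicalType) :
  strong_sigma_space X -> closed_bar_Gdelta X.
Proof.
move=> [[Xreg _] [N [G sG ->] net]] F cF.
have /choice[B BP] (A : set X) : exists B : set X,
    [/\ open B, closure B `<=` ~` F & (exists C : set X,
      [/\ open C, closure C `<=` ~` F & A `<=` C]) -> A `<=` B].
  have [[C [oC CF AC]]|no] := pselect (exists C : set X,
      [/\ open C, closure C `<=` ~` F & A `<=` C]); first by exists C.
  by exists set0; split=> //; [exact: open0|rewrite closure0].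
have /choice[V VP] n : exists V : set X -> set X,
    (forall A, G n A -> open (V A) /\ A `<=` V A) /\ discrete_family (G n) V.
  by have [V ? ?] := sG n; exists V.
pose P n := \bigcup_(A in G n) (B A `&` V n A).
have oP n : open (P n).
  apply: bigcup_open => A GA; apply: openI; first by case: (BP A).
  by case: ((VP n).1 A GA).
have PF n : closure (P n) `<=` ~` F.
  move=> x /(closure_discrete_bigcup (F := fun A => B A `&` V n A)) [].
    by apply: sub_discrete_family (VP n).2 => // A _ y [].
  move=> A GA /(closure_subset (@subIsetl _ _ _)).
  by have [_ + _] := BP A; apply.
have cov x : ~ F x -> exists n, P n x.
  move=> xF; have xnF : nbhs x (~` F).
    by apply: open_nbhs_nbhs; split=> //; exact: closed_openC.
  have [C xC CF] := Xreg x _ xnF.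
  have [A [n _ GA] [Ax AC]] := net C° x (open_interior _) xC.
  exists n, A => //; split; last by case: ((VP n).1 A GA) => _; apply.
  have [_ _ AB] := BP A; apply: AB Ax; exists C°; split=> //.
    exact: open_interior.
  by apply: subset_trans CF; exact: closure_subset (@interior_subset _ _).
have FW n : F `<=` ~` closure (P n) by move=> x Fx /PF.
have WF : \bigcap_n closure (~` closure (P n)) `<=` F.
  move=> x xW; apply: contrapT => /cov[n Px].
  have [y [yP Py]] := xW n I _ (open_nbhs_nbhs (conj (oP n) Px)).
  exact/yP/subset_closure.
exists (fun n => ~` closure (P n)); split.
- by move=> n; exact/closed_openC/closed_closure.
- apply/seteqP; split; first by move=> x Fx n _; exact: FW.
  by apply: subset_trans WF => x xW n nI; exact/subset_closure/xW.
apply/seteqP; split=> // x Fx n _; exact/subset_closure/FW.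
Qed.

(** * Metrization under each of the conditions *)

Section to_metrizable.
Variables (R : realType) (X : topologicalType).
Variable U : (nat -> nat) -> set (X * X).
Hypothesis hU : locally_uniform_base U.
Hypothesis Xfc : first_countable X.

Lemma closed_bar_Gdelta_metrizable :
  kolmogorov_space X -> closed_bar_Gdelta X -> metrizable R X.
Proof.
move=> X0 Gd; have cdom s : closed (~` prefix_domain U s).
  exact/open_closedC/prefix_domain_open.
have /choice[W WP] s := Gd _ (cdom s).
apply: (metrizable_of_shrinking hU R (P := fun s n => ~` closure (W s n))) => //.
- by move=> s n; exact/closed_openC/closed_closure.
- move=> s n x xW; have [oW WE _] := WP s.
  apply: contrapT => xd; have : (~` prefix_domain U s) x by [].
  rewrite WE => /(_ n I) Wx.
  have [y [/(_ _)]] := xW _ (open_nbhs_nbhs (conj (oW n) Wx)).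
  by move=> nW Wy; apply: nW; exact: subset_closure.
move=> a x; have [m xm] := prefix_domain_cover hU a x Xfc; exists m.
have [_ _ WE] := WP (mkseq a m); apply: contrapT => /forallNP no.
have : (~` prefix_domain U (mkseq a m)) x.
  by rewrite WE => n _; apply: contrapT; exact: no.
by apply.
Qed.

(** The domains [O_{a|m}] increase with [m] and cover [X], so a countably compact
set is inside one of them. *)
Lemma Sigma_metrizable :
  collectionwise_normal X -> Sigma_space X -> metrizable R X.
Proof.
move=> cwn [[_ X0] [CC [N [Ccov CCP [G dG ->] CN]]]].
pose D s n := [set A | G n A /\ closure A `<=` prefix_domain U s].
have odom s := prefix_domain_open U s.
have /choice[P PP] (sn : seq nat * nat) : exists P, [/\ open P,
    \bigcup_(A in D sn.1 sn.2) A `<=` P & closure P `<=` prefix_domain U sn.1].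
  have [|P [oP FP Pd]] := collectionwise_normal_shrink cwn
      (@closed_closure _ (\bigcup_(A in D sn.1 sn.2) A)) (odom sn.1).
    have dD : discrete_family (D sn.1 sn.2) id.
      by apply: sub_discrete_family (dG sn.2) => [A []|A _ x].
    by move=> x /(closure_discrete_bigcup dD)[A [_ Ad] /Ad].
  by exists P; split=> //; exact: subset_trans (@subset_closure _ _) FP.
apply: (metrizable_of_shrinking hU R (P := fun s n => P (s, n))) => //.
- by move=> s n; case: (PP (s, n)).
- by move=> s n; case: (PP (s, n)).
move=> a x; have [C CCC Cx] : cover CC id x by rewrite Ccov.
have [cC ccC] := CCP C CCC.
have [|D' _ CD'] := ccC (fun m => prefix_domain U (mkseq a m)) (fun=> odom _).
  by move=> y _; have [m ym] := prefix_domain_cover hU a y Xfc; exists m.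
pose m := \max_(i <- finmap.enum_fset D') i.
have Cm : C `<=` prefix_domain U (mkseq a m).
  move=> y /CD' [i /= iD]; apply: prefix_domain_incr.
  exact: (@leq_bigmax_seq _ (finmap.enum_fset D') xpredT id).
have [V [oV CV Vm]] := collectionwise_normal_shrink cwn cC (odom _) Cm.
have [A [n _ GA] [CA AV]] := CN C V CCC oV CV.
exists m, n; have [_ + _] := PP (mkseq a m, n); apply.
exists A; last exact: CA.
by split=> //; apply: subset_trans Vm; exact: closure_subset.
Qed.

End to_metrizable.

(** * M-spaces *)

Lemma regular_T0_separate (X : topologicalType) (p x : X) :
  regular_T0 X -> p != x -> exists V : set X, [/\ open V, V p & ~ closure V x].
Proof.
move=> [Xreg X0] /X0[A [[]|[]]]; rewrite !inE => Ap Ax.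
  have [B Bp BA] := Xreg p A Ap.
  exists B°; split=> //; first exact: open_interior.
  by move=> /(closure_subset (@interior_subset _ _))/BA.
have [B Bx BA] := Xreg x A Ap; exists (~` closure B); split.
- exact/closed_openC/closed_closure.
- by move=> /BA.
move=> /(_ _ Bx)[y [By yB]]; exact/By/subset_closure.
Qed.

Section M_space.
Variables (X : topologicalType) (UU : nat -> set (set X)).
Hypothesis UUopen : forall n, open_cover (UU n).
Hypothesis UUstar : forall n, star_refines (UU n.+1) (UU n).

Definition cover_star n x : set X := \bigcup_(V in [set V | UU n V /\ V x]) V.

Let UU_at n x : exists2 V, UU n V & V x.
Proof.
have [_ UUc] := UUopen n; have : cover (UU n) id x by rewrite UUc.
by move=> [V]; exists V.
Qed.

Lemma star_nbhs n x : nbhs x (cover_star n x).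
Proof.
have [V UV Vx] := UU_at n x; have [UUo _] := UUopen n.
apply: (@filterS _ _ _ V) => [y Vy|]; first by exists V.
by apply: open_nbhs_nbhs; split=> //; exact: UUo.
Qed.

Lemma star_sym n x y : cover_star n x y -> cover_star n y x.
Proof. by move=> [V [UV Vx] Vy]; exists V. Qed.

Lemma star_trans n x y z :
  cover_star n.+1 x y -> cover_star n.+1 y z -> cover_star n x z.
Proof.
move=> [V [UV Vx] Vy] [W [UW Wy] Wz]; have [O UO VO] := UUstar UV.
exists O; first by split=> //; apply: VO; exists V => //; split=> //; exists x.
by apply: VO; exists W => //; split=> //; exists y.
Qed.

Lemma star_decr m n x : (m <= n)%N -> cover_star n x `<=` cover_star m x.
Proof.
move=> mn; rewrite -(subnKC mn); elim: (n - m)%N => [|k IH].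
  by rewrite addn0.
rewrite addnS => y xy; apply: IH; apply: star_trans xy _.
exact: nbhs_singleton (star_nbhs _ _).
Qed.

Lemma closure_star n x : closure (cover_star n.+1 x) `<=` cover_star n x.
Proof.
move=> y /(_ _ (star_nbhs n.+1 y))[z [xz /star_sym zy]].
exact: star_trans xz zy.
Qed.

Hypothesis UUcluster : forall (x : X) (x_ : nat -> X),
  (forall n, cover_star n x (x_ n)) -> cluster (x_ @ \oo) !=set0.

(** The accumulation point is in all the stars of [x] because the closure of a
star is inside the star of the previous level. *)
Lemma star_cluster x x_ : (forall n, cover_star n x (x_ n)) ->
  exists p, (forall n, cover_star n x p) /\
    forall O, nbhs p O -> forall n, exists2 m, (n <= m)%N & O (x_ m).
Proof.
move=> xx; have [p pc] := UUcluster xx.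
have often (O : set X) : nbhs p O -> forall n, exists2 m, (n <= m)%N & O (x_ m).
  move=> pO n; have nx : (x_ @ \oo) (x_ @` [set m | (n <= m)%N]).
    by exists n => // m nm; exists m.
  by have [_ [[m nm <-] Om]] := pc _ _ nx pO; exists m.
exists p; split=> // n; apply: closure_star => O pO.
have [m nm Om] := often _ pO n.+1; exists (x_ m); split=> //.
exact: star_decr nm _ (xx m).
Qed.

Variable U : (nat -> nat) -> set (X * X).
Hypothesis hU : locally_uniform_base U.

(* [close a] is the relation [U_a U_a^-1]. *)
Let close a x y := exists c, U a (c, x) /\ U a (c, y).

Let close_decr a b x y :
  (forall n, (a n <= b n)%N) -> close b x y -> close a x y.
Proof.
by move=> ab [c [cx cy]]; exists c; split; apply: (omega_base_decr hU ab).
Qed.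

Let prefix_close s x y := forall b, cylinder s b -> close b x y.

(** Otherwise there are [x_m] in the [m]-th star of [x], and [b_m] extending [a|m],
such that [x_m] is not [U_{b_m} U_{b_m}^-1]-close to the earlier [x_i].  For a
common bound [c] of the [b_m] no two of the points [x_m] are
[U_c U_c^-1]-close, although infinitely many of them are in [U_c[p]] for an
accumulation point [p].  A finite set of failures, one for each earlier point,
is witnessed by a single [b_m], the maximum of the individual witnesses. *)
Lemma star_totally_bounded x a : exists (m : nat) (D : seq X),
  forall y, cover_star m x y -> exists2 d, d \in D & prefix_close (mkseq a m) d y.
Proof.
apply: contrapT => no.
have far (mD : nat * seq X) : exists yb : X * (nat -> nat),
    [/\ cover_star mD.1 x yb.1, cylinder (mkseq a mD.1) yb.2 &
      forall d, d \in mD.2 -> ~ close yb.2 d yb.1].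
  case: mD => m D /=; have [y xy yD] : exists2 y, cover_star m x y &
      forall d, d \in D -> ~ prefix_close (mkseq a m) d y.
    apply: contrapT => nof; apply: no; exists m, D => y xy.
    apply: contrapT => nod; apply: nof; exists y => // d dD dy.
    by apply: nod; exists d.
  suff [b ab bD] : exists2 b, cylinder (mkseq a m) b &
      forall d, d \in D -> ~ close b d y by exists (y, b).
  elim: D yD => [_|d D IH yD]; first by exists a => //; exact: cylinder_self.
  have [|b ab bD] := IH; first by move=> e eD; apply: yD; rewrite inE eD orbT.
  have [b' ab' b'd] : exists2 b', cylinder (mkseq a m) b' & ~ close b' d y.
    apply: contrapT => nob; apply: (yD d (mem_head _ _)) => b' ab'.
    by apply: contrapT => nc; apply: nob; exists b'.
  exists (fun n => maxn (b n) (b' n)).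
    apply/cylinder_mkseq => i im; move/cylinder_mkseq: ab => ->//.
    by move/cylinder_mkseq: ab' => ->//; rewrite maxnn.
  move=> e; rewrite inE => /orP[/eqP->|eD].
    by apply: contra_not b'd; apply: close_decr => n; exact: leq_maxr.
  by apply: contra_not (bD e eD); apply: close_decr => n; exact: leq_maxl.
have {far}/choice[f fP] := far.
pose L := fix L m := if m is n.+1 then (f (n, L n)).1 :: L n else [::].
pose x_ m := (f (m, L m)).1.
have xL i m : (i < m)%N -> x_ i \in L m.
  elim: m => // m IH; rewrite ltnS leq_eqVlt inE => /orP[/eqP->|/IH->].
    by rewrite eqxx.
  by rewrite orbT.
have [|c cP] := @cylinder_ub a (fun m => (f (m, L m)).2).
  by move=> m; case: (fP (m, L m)).
have [|p [_ pc]] := @star_cluster x x_; first by move=> m; case: (fP (m, L m)).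
have [i _ pi] := pc _ (omega_base_nbhs hU c p) 0%N.
have [m im pm] := pc _ (omega_base_nbhs hU c p) i.+1.
have [_ _ /(_ _ (xL _ _ im))] := fP (m, L m); apply.
by apply: close_decr (cP m) _; exists p.
Qed.

(** The sets [N k], for [k] ranging over the pairs of a finite sequence and a
position in its finite set [D], form a network at each [p] in all the stars of
[x]: if [p] is in [V] then some [N k] contains [p] and is inside [V].  For each
[N k] that has an open neighbourhood whose closure omits [x], fix one, [G k].  The
stars of [x] minus the closures of finitely many [G k] form a base at [x]: if
[x_n] is in the [n]-th of these sets but not in [O], an accumulation point [p]
differs from [x], so it is in some [G k], which contains only finitely many
[x_n]. *)
Lemma M_space_first_countable : regular_T0 X -> first_countable X.
Proof.
move=> XT x.
have /choice[D DP] (s : seq nat) : exists D : seq X,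
    (exists D' : seq X, forall y, cover_star (size s) x y ->
      exists2 d, d \in D' & prefix_close s d y) ->
    forall y, cover_star (size s) x y -> exists2 d, d \in D & prefix_close s d y.
  by have [[D' ?]|no] := pselect (exists D' : seq X, forall y,
    cover_star (size s) x y -> exists2 d, d \in D' & prefix_close s d y);
    [exists D'|exists [::]].
pose N (k : seq nat * nat) := [set y | prefix_close k.1 (nth x (D k.1) k.2) y].
have /choice[G GP] (k : seq nat * nat) : exists G : set X,
    [/\ open G, ~ closure G x &
      (exists V : set X, [/\ open V, ~ closure V x & N k `<=` V]) -> N k `<=` G].
  have [[V [oV Vx NV]]|no] := pselect (exists V : set X,
      [/\ open V, ~ closure V x & N k `<=` V]); first by exists V.
  by exists set0; split=> //; [exact: open0|rewrite closure0].
pose B n := cover_star n x `&`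
  [set y | forall k, (pickle k < n)%N -> ~ closure (G k) y].
have B_nbhs n : nbhs x (B n).
  apply: filterI (star_nbhs n x) _; apply: nbhs_forall_pickle => k.
  apply: open_nbhs_nbhs; split; first exact/closed_openC/closed_closure.
  by case: (GP k).
exists (range B); first exact: card_image_le.
apply/seteqP; split=> [O xO|O [_ [n _ <-] nO]]; last exact: filterS (B_nbhs n).
apply: contrapT => noB.
have /choice[x_ xP] n : exists y, B n y /\ ~ O y.
  apply: contrapT => no; apply: noB; exists (B n); first by exists n.
  by move=> y By; apply: contrapT => nOy; apply: no; exists y.
have [n|p [xp pc]] := @star_cluster x x_; first by case: (xP n) => -[].
have px : p != x.
  apply/eqP => px; rewrite -px in xO; have [m _] := pc _ xO 0%N.
  exact: (xP m).2.
have [V [oV Vp Vx]] := regular_T0_separate XT px.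
have [a aV] := omega_base_four_steps hU (open_nbhs_nbhs (conj oV Vp)).
have [m [E mE]] := star_totally_bounded x a.
have := DP (mkseq a m); rewrite size_mkseq => /(_ (ex_intro _ E mE) p (xp m)).
move=> [d dD dp]; pose k := (mkseq a m, index d (D (mkseq a m))).
have Nk : N k = [set y | prefix_close (mkseq a m) d y].
  by rewrite /N /k /= nth_index.
have [oG _ NG] := GP k.
have Gp : G k p.
  apply: NG; last by rewrite Nk.
  exists V; split=> //; rewrite Nk => y dy.
  have [c [cd cp]] := dp a (@cylinder_self a m).
  have [c' [c'd c'y]] := dy a (@cylinder_self a m).
  exact: aV cp cd c'd c'y.
have [n kn Gn] := pc _ (open_nbhs_nbhs (conj oG Gp)) (pickle k).+1.
have [[_ /(_ _ kn)]] := xP n; case; exact: subset_closure.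
Qed.

Lemma M_space_metrizable (R : realType) : regular_T0 X -> metrizable R X.
Proof.
move=> XT; have Xfc := M_space_first_countable XT.
apply: (metrizable_of_shrinking hU R
  (P := fun s n => [set y | cover_star n y `<=` prefix_domain U s]°)).
- by case: XT.
- by move=> s n; exact: open_interior.
- move=> s n y /(_ _ (star_nbhs n y))[z [/interior_subset zs yz]].
  exact/zs/star_sym.
move=> a x; suff [n xn] : exists n, cover_star n x `<=` prefix_domain U (mkseq a n).
  exists n, n.+1; apply: filterS (star_nbhs n.+1 x) => y xy z yz.
  exact/xn/(star_trans xy).
apply: contrapT => no.
have /choice[x_ xP] n : exists y, cover_star n x y /\ ~ prefix_domain U (mkseq a n) y.
  apply: contrapT => noy; apply: no; exists n => y xy.
  by apply: contrapT => yn; apply: noy; exists y.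
have [n|p [_ pc]] := @star_cluster x x_; first by case: (xP n).
have [m pm] := prefix_domain_cover hU a p Xfc.
have [n mn xn] := pc _ (open_nbhs_nbhs (conj (prefix_domain_open U _) pm)) m.
by apply: (xP n).2; exact: prefix_domain_incr mn _ xn.
Qed.

End M_space.

(** * Properties of metric spaces *)

Lemma strongly_sigma_discrete_countable (X : topologicalType) (I : countType)
    (G : I -> set (set X)) :
  (forall i, strongly_discrete (G i)) ->
  strongly_sigma_discrete (\bigcup_i G i).
Proof.
move=> dG; exists (fun n => if unpickle n is Some i then G i else set0).
  move=> n; case: unpickle => [i|]; first exact: dG.
  by exists id => // x; exists setT; first exact: filterT.
apply/seteqP; split=> [A [i _ GA]|A [n _]].
  by exists (pickle i); rewrite // pickleK.
by case: unpickle => // i GA; exists i.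
Qed.

Lemma strongly_sigma_discrete_sigma (X : topologicalType) (N : set (set X)) :
  strongly_sigma_discrete N -> sigma_discrete N.
Proof.
move=> [G sG ->]; exists G => // n; have [V VP dV] := sG n.
by apply: sub_discrete_family dV => // A /VP[].
Qed.

Section compatible_metric_theory.
Local Open Scope ring_scope.
Variables (R : realType) (X : topologicalType) (d : X -> X -> R).
Hypothesis hd : compatible_metric d.

Let d0 x : d x x = 0.
Proof. by case: hd => -[]. Qed.

Let deq x y : d x y = 0 -> x = y.
Proof. by case: hd => -[_ + _ _] _; exact. Qed.

Let dC x y : d x y = d y x.
Proof. by case: hd => -[]. Qed.

Let dtri y x z : d x z <= d x y + d y z.
Proof. by case: hd => -[]. Qed.

Let dnbhs (x : X) (A : set X) :
  nbhs x A <-> exists2 e : R, 0 < e & forall y, d x y < e -> A y.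
Proof. by case: hd. Qed.

Let ball_nbhs (x : X) e : 0 < e -> nbhs x [set y | d x y < e].
Proof. by move=> e0; apply/dnbhs; exists e. Qed.

Let ball_open (x : X) e : open [set y | d x y < e].
Proof.
rewrite openE => y /= xy; apply/dnbhs; exists (e - d x y); first by lra.
by move=> z yz /=; have := dtri y x z; lra.
Qed.

Let inv (n : nat) : R := n.+1%:R^-1.

Let small (e : R) : 0 < e -> exists n : nat, inv n < e.
Proof. by move=> /ltr_add_invr[n]; rewrite add0r; exists n. Qed.

Let inv_gt0 n : 0 < inv n.
Proof. by rewrite invr_gt0. Qed.

Let inv_le m n : (m <= n)%N -> inv n <= inv m.
Proof. by move=> mn; rewrite lef_pV2 ?posrE // ler_nat ltnS. Qed.

Lemma metric_first_countable : first_countable X.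
Proof.
move=> x; exists (range (fun n => [set y | d x y < inv n])).
  exact: card_image_le.
apply/seteqP; split=> [A /dnbhs[e e0 eA]|A [_ [n _ <-]]].
  have [n ne] := small e0; exists [set y | d x y < inv n]; first by exists n.
  by move=> y /= xy; apply: eA; exact: lt_trans ne.
by move=> nA; apply: filterS nA _; exact: ball_nbhs.
Qed.

Lemma metric_regular_T0 : regular_T0 X.
Proof.
split=> [x A /dnbhs[e e0 eA]|x y /eqP xy].
  exists [set y | d x y < e / 2]; first by apply: ball_nbhs; lra.
  move=> y /(_ [set z | d y z < e / 2])[|z [/= xz yz]].
    by apply: ball_nbhs; lra.
  by apply: eA; have := dtri z x y; rewrite (dC z y); lra.
have dxy : 0 < d x y.
  rewrite lt_neqAle; apply/andP; split.
    by apply/eqP => /esym/deq.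
  by have := dtri y x x; rewrite d0 (dC y x); lra.
exists [set z | d x z < d x y]; left; rewrite !inE; split; first exact: ball_nbhs.
by rewrite /= ltxx.
Qed.

(** Around [x] choose [r x] such that the ball of radius [r x] meets at most one
member.  Balls of radius [r a / 4] and [r b / 4] around points [a], [b] of
different members, both meeting the ball of radius [r z / 4] around [z], have
centres at distance at least [max (r a) (r b)]; this forces [d a b < r z] and
both centres to be within [r z] of [z]. *)
Lemma metric_strongly_discrete (FF : set (set X)) :
  discrete_sets FF -> strongly_discrete FF.
Proof.
move=> dF; have /choice[r rP] x : exists e : R, 0 < e /\
    forall F G a b, FF F -> FF G -> F a -> G b -> d x a < e -> d x b < e -> F = G.
  have [O /dnbhs[e e0 eO] OF] := dF x; exists e; split=> // F G a b FFF FFG Fa Gb.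
  by move=> xa xb; apply: OF => //; [exists a|exists b]; split=> //; exact: eO.
exists (fun F => \bigcup_(x in F) [set y | d x y < r x / 4]).
  move=> F _; split; first by apply: bigcup_open => x _; exact: ball_open.
  by move=> x Fx; exists x => //=; rewrite d0; have [] := rP x; lra.
move=> z; have [rz rzP] := rP z.
exists [set y | d z y < r z / 4]; first by apply: ball_nbhs; lra.
move=> F G FFF FFG [y /= [zy [a Fa /= ay]]] [y' /= [zy' [b Gb /= by']]].
apply: contrapT => FG.
have ab : r a <= d a b.
  rewrite leNgt; apply/negP => ab; apply: FG; have [ra raP] := rP a.
  by apply: (raP F G a b) => //; rewrite d0.
have ba : r b <= d a b.
  rewrite leNgt; apply/negP => ba; apply: FG; have [rb rbP] := rP b.
  by apply: (rbP F G a b) => //; rewrite ?d0 // dC.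
have := dtri y a b; have := dtri z y b; have := dtri y' z b.
rewrite (dC y z) (dC y' b) => t1 t2 t3.
have := dtri y z a; have := dtri y' z b; rewrite (dC y a) (dC y' b) => t4 t5.
have ra := (rP a).1; have rb := (rP b).1.
by apply: FG; apply: (rzP F G a b) => //; lra.
Qed.

(** Stone's construction.  With [k = (m, n)], assign each point to the least
[a] whose ball of radius [1 / (m+1)] contains it, and keep in [S k a] the points
for which that ball contains also the ball of radius [1 / (n+1)] around the
point.  Points of [S k a] and [S k b] closer than [1 / (n+1)] give [a <= b] and
[b <= a], so the family is discrete. *)
Lemma metric_network : exists2 N : set (set X),
  strongly_sigma_discrete N & network N.
Proof.
have [le wo] := well_ordering_principle X.
pose S (k : nat * nat) a := [set x | [/\ d a x < inv k.1,
  forall b, d b x < inv k.1 -> le a b &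
  forall y, d x y < inv k.2 -> d a y < inv k.1]].
have le_anti a b : le a b -> le b a -> a = b.
  move=> ab ba; have anti := wo_chain_antisymmetric (withinW (A := predT) wo).
  by apply: anti; rewrite ?inE // ab.
exists (\bigcup_k range (S k)).
  apply: strongly_sigma_discrete_countable => k.
  apply: metric_strongly_discrete => z.
  exists [set y | d z y < inv k.2 / 2].
    by apply: ball_nbhs; rewrite divr_gt0.
  move=> _ _ [a _ <-] [b _ <-] [x [/= zx [ax xa xk]]] [y [/= zy [bY yb yk]]].
  have xy : d x y < inv k.2 by have := dtri z x y; rewrite (dC x z); lra.
  by congr (S k _); apply: le_anti; [apply/xa/yk; rewrite dC|exact/yb/xk].
move=> O x oO Ox; have /dnbhs[e e0 eO] := open_nbhs_nbhs (conj oO Ox).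
have [m me] := small (divr_gt0 e0 (ltr0Sn _ 1)).
have [|a [[]]] := wo [pred a | d a x < inv m].
  by exists x; rewrite inE d0.
rewrite inE => ax amin _.
have [n na] : exists n : nat, inv n < inv m - d a x.
  by apply: small; lra.
exists (S (m, n) a); first by exists (m, n) => //; exists a.
split; first split=> //=.
  by move=> y xy; have := dtri x a y; lra.
by move=> y [/= ay _ _]; apply: eO; have := dtri a x y; rewrite (dC x a); lra.
Qed.

Lemma metric_strong_sigma : strong_sigma_space X.
Proof. by split; [exact: metric_regular_T0|exact: metric_network]. Qed.

Lemma metric_Sigma : Sigma_space X.
Proof.
split; first exact: metric_regular_T0.
have [N sN net] := metric_network.
exists (range (fun x : X => [set x])), N; split.
- by apply/seteqP; split=> // x _; exists [set x] => //; exists x.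
- move=> _ [x _ <-]; split; last first.
    move=> V oV /(_ x erefl)[n _ Vx].
    exists (finmap.fset1 n); first by move=> m _; rewrite inE.
    by move=> _ ->; exists n => //=; rewrite finmap.inE.
  have xT1 : accessible_space X.
    move=> a b ab; have [V [oV Va Vb]] := regular_T0_separate metric_regular_T0 ab.
    exists V; split; rewrite ?inE // => Vb'; exact/Vb/subset_closure.
  exact: accessible_closed_set1.
- exact: strongly_sigma_discrete_sigma.
move=> _ V [x _ <-] oV xV; have [A NA [Ax AV]] := net V x oV (xV x erefl).
by exists A => //; split=> // _ ->.
Qed.

Lemma metric_M_space : M_space X.
Proof.
split; first exact: metric_regular_T0.
(* Two balls of radius [r] that meet are in the ball of radius [3 r] around the
   centre of either. *)
pose r n : R := (3 ^+ n)^-1.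
have r0 n : 0 < r n by rewrite invr_gt0 exprn_gt0.
have rS n : r n = 3 * r n.+1.
  by rewrite /r exprS invfM mulrA divff ?mul1r ?pnatr_eq0.
have r_small n : r n <= inv n.
  by rewrite lef_pV2 ?posrE ?exprn_gt0 // -natrX ler_nat ltn_expl.
exists (fun n => range (fun a => [set x | d a x < r n])); split.
- move=> n; split; first by move=> _ [a _ <-]; exact: ball_open.
  apply/seteqP; split=> // x _; exists [set y | d x y < r n]; first by exists x.
  by rewrite /= d0.
- move=> n _ [a _ <-]; exists [set x | d a x < r n]; first by exists a.
  move=> x [_ [[b _ <-] [y /= [bY ay]]] bx] /=.
  have := dtri y a x; have := dtri b y x; rewrite (dC y b) rS.
  by have := r0 n.+1; lra.
move=> x x_ xx.
have dx n : d x (x_ n) < 2 * inv n.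
  have [_ [[a _ <-] /= ax] /= ax_] := xx n.
  by have := dtri a x (x_ n); rewrite (dC x a); have := r_small n; lra.
exists x => A B [n _ nA] /dnbhs[e e0 eB].
have [m me] := small (divr_gt0 e0 (ltr0Sn _ 1)).
exists (x_ (maxn m n)); split; first by apply: nA; exact: leq_maxr.
apply: eB; apply: lt_le_trans (dx _) _.
by have := inv_le (leq_maxl m n); lra.
Qed.

Lemma metric_collectionwise_normal : collectionwise_normal X.
Proof. by move=> FF _; exact: metric_strongly_discrete. Qed.

End compatible_metric_theory.

(** * The equivalence *)

Theorem theorem6p2 (R : realType) (X : topologicalType)
    (U : (nat -> nat) -> set (X * X)) (hU : locally_uniform_base U) :
  [<-> metrizable R X;
       [/\ first_countable X, closed_bar_Gdelta X & @kolmogorov_space X];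
       M_space X;
       [/\ first_countable X, collectionwise_normal X & Sigma_space X];
       first_countable X /\ strong_sigma_space X].
Proof.
split=> [/metrizableP[d hd]|].
  split; first exact: metric_first_countable hd.
    exact/strong_sigma_closed_bar_Gdelta/(metric_strong_sigma hd).
  by case: (metric_regular_T0 hd).
split=> [[fc gd X0]|].
  have /metrizableP[d hd] := closed_bar_Gdelta_metrizable R hU fc X0 gd.
  exact: metric_M_space hd.
split=> [[XT [UU [UUo UUs UUc]]]|].
  have /metrizableP[d hd] := M_space_metrizable UUo UUs UUc hU R XT.
  split; [exact: metric_first_countable hd|
    exact: metric_collectionwise_normal hd|exact: metric_Sigma hd].
split=> [[fc cwn sigma]|[fc strong]].
  have /metrizableP[d hd] := Sigma_metrizable R hU fc cwn sigma.
  by split; [exact: metric_first_countable hd|exact: metric_strong_sigma hd].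
apply: (closed_bar_Gdelta_metrizable R hU fc); first by case: strong => -[].
exact: strong_sigma_closed_bar_Gdelta.
Qed.
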